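(* Let $\Phi$ be a Euclidean domain, let $0\neq z\in\Phi\setminus\Phi^*$, and let $B=\Phi_C\langle x,y\rangle$ be the free nonassociative commutative algebra over $\Phi$ with free generators $x,y$. Then $$\omega=\bigl(x+2y(zx-y^2)+z(zx-y^2)^2,\; y+z(zx-y^2)\bigr)$$ is a wild automorphism of $B$.
   Context: A Euclidean domain here is a (commutative) integral domain $\Phi$ that is not a field, for which there is a function (norm) $|\cdot|:\Phi\setminus\{0\}\to\mathbb{Z}_+=\{0,1,2,\dots\}$ such that: (E1) for all $a,b\in\Phi\setminus\{0\}$, $|ab|\ge |a|$, with equality only when $b$ is invertible; (E2) for all $a,b\in\Phi$ with $b\ne 0$ there are $q,r\in\Phi$ with $a=bq+r$ and either $r=0$ or $|r|<|b|$. $\Phi^*$ denotes the set of invertible elements of $\Phi$. The algebra $B$ is the free commutative, not necessarily associative, $\Phi$-algebra on $x,y$ (free in the variety of algebras satisfying $uv=vu$); $u^2$ denotes $u\cdot u$. The notation $(f_1,f_2)$ denotes the $\Phi$-algebra endomorphism $\phi$ with $\phi(x)=f_1$, $\phi(y)=f_2$. Elementary automorphisms of $B$ are those of the form $(\alpha x+f,\,y)$ with $\alpha\in\Phi^*$ and $f$ in the subalgebra generated by $y$, or $(x,\,\beta y+g)$ with $\beta\in\Phi^*$ and $g$ in the subalgebra generated by $x$. An automorphism is tame if it belongs to the subgroup of $\mathrm{Aut}(B)$ generated by all elementary automorphisms, and wild otherwise. *)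

(* Defs.v *)
From HB Require Import structures.
From mathcomp Require Import all_boot all_algebra finmap.
From mathcomp.multinomials Require Import monalg.

Set Implicit Arguments.
Unset Strict Implicit.
Unset Printing Implicit Defensive.

Import GRing.Theory.
Local Open Scope ring_scope.

(** * Euclidean domains *)

(* Only the values of [N] at nonzero arguments matter. *)
Definition euclidean_norm (Phi : idomainType) (N : Phi -> nat) : Prop :=
  (forall a b : Phi, a != 0 -> b != 0 ->
     (N a <= N (a * b)%R)%N /\ (N (a * b)%R = N a -> b \is a GRing.unit)) /\
  (forall a b : Phi, b != 0 ->
     exists q r : Phi, a = b * q + r /\ (r = 0 \/ (N r < N b)%N)).

Definition euclidean_domain (Phi : idomainType) : Prop :=
  (exists a : Phi, a != 0 /\ a \isn't a GRing.unit) /\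
  (exists N : Phi -> nat, euclidean_norm N).

(** * Commutative, not necessarily associative or unital, algebras *)

HB.mixin Record Lmodule_isCommNAlg (R : comNzRingType) V
    of GRing.Lmodule R V := {
  nmul : V -> V -> V;
  nmulC : commutative nmul;
  nmulDl : left_distributive nmul +%R;
  nmulZl : forall (a : R) (u v : V), nmul (a *: u) v = a *: nmul u v
}.

#[short(type="commNAlgType")]
HB.structure Definition CommNAlg (R : comNzRingType) :=
  { V of GRing.Lmodule R V & Lmodule_isCommNAlg R V }.

Notation "u ** v" := (nmul u v) (at level 40, left associativity) : ring_scope.

Definition alg_hom (R : comNzRingType) (A B : commNAlgType R) (f : A -> B) :
    Prop :=
  linear f /\ {morph f : u v / u ** v}.

Definition alg_aut (R : comNzRingType) (A : commNAlgType R) (f : A -> A) :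
    Prop :=
  alg_hom f /\ bijective f.

Inductive subalg_gen (R : comNzRingType) (A : commNAlgType R) (S : A -> Prop) :
    A -> Prop :=
| subalg_mem u : S u -> subalg_gen S u
| subalg_0 : subalg_gen S 0
| subalg_add u v : subalg_gen S u -> subalg_gen S v -> subalg_gen S (u + v)
| subalg_scale (a : R) u : subalg_gen S u -> subalg_gen S (a *: u)
| subalg_mul u v : subalg_gen S u -> subalg_gen S v -> subalg_gen S (u ** v).

(** * The free commutative magma on two generators *)

Inductive btree : Type := TX | TY | TNode of btree & btree.

Fixpoint btree_encode (t : btree) : GenTree.tree nat :=
  match t with
  | TX => GenTree.Leaf 0%N
  | TY => GenTree.Leaf 1%N
  | TNode s u => GenTree.Node 0 [:: btree_encode s; btree_encode u]
  end.

Fixpoint btree_decode (g : GenTree.tree nat) : btree :=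
  match g with
  | GenTree.Leaf 0 => TX
  | GenTree.Node _ [:: s; u] => TNode (btree_decode s) (btree_decode u)
  | _ => TY
  end.

Lemma btree_encodeK : cancel btree_encode btree_decode.
Proof. by elim=> //= s -> u ->. Qed.

HB.instance Definition _ := Countable.copy btree (can_type btree_encodeK).

(* A commutative monomial is represented by the unique tree of its class in
   which the children of every node are nondecreasing; the total order used
   for this, comparison of codes in [nat], is arbitrary. *)
Definition btree_le (s t : btree) : bool := (choice.pickle s <= choice.pickle t)%N.

Fixpoint normal (t : btree) : bool :=
  if t is TNode s u then [&& normal s, normal u & btree_le s u] else true.

Record cmonom : Type := CMonom { cmonom_tree : btree; _ : normal cmonom_tree }.

HB.instance Definition _ := [isSub for cmonom_tree].
HB.instance Definition _ := [Countable of cmonom by <:].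

Definition mX : cmonom := @CMonom TX isT.
Definition mY : cmonom := @CMonom TY isT.

Definition node (s t : btree) : btree :=
  if btree_le s t then TNode s t else TNode t s.

Lemma node_normal (s t : cmonom) :
  normal (node (cmonom_tree s) (cmonom_tree t)).
Proof.
case: s t => [s hs] [t ht] /=; rewrite /node.
case: ifP => [le_st|/negbT]; first by rewrite /= hs ht le_st.
by rewrite /btree_le -ltnNge => /ltnW lt_ts; rewrite /= hs ht.
Qed.

Definition cmul (s t : cmonom) : cmonom := CMonom (node_normal s t).

Lemma cmulC : commutative cmul.
Proof.
move=> [s hs] [t ht]; apply: val_inj; rewrite /= /node /btree_le.
case: (ltngtP (choice.pickle s) (choice.pickle t)) => // /(pcan_inj choice.pickleK) -> //.
Qed.

Lemma cmonom_elim (P : cmonom -> Prop) :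
  P mX -> P mY -> (forall s t, P s -> P t -> P (cmul s t)) -> forall s, P s.
Proof.
move=> PX PY PM [t ht]; elim: t ht => [||s IHs u IHu] ht.
- by have -> : CMonom ht = mX by apply: val_inj.
- by have -> : CMonom ht = mY by apply: val_inj.
case/and3P: (ht) => hs hu le_su.
have -> : CMonom ht = cmul (CMonom hs) (CMonom hu).
  by apply: val_inj; rewrite /= /node le_su.
exact: PM.
Qed.

(** * The free commutative algebra on two generators *)

Definition freeC (R : comNzRingType) : Type := {malg R[cmonom]}.

HB.instance Definition _ (R : comNzRingType) :=
  GRing.Lmodule.copy (freeC R) {malg R[cmonom]}.

Section FreeC.
Context (R : comNzRingType).
Implicit Types u v : freeC R.

Definition freeC_mul u v : freeC R :=
  \sum_(s <- msupp u) \sum_(t <- msupp v) << u@_s * v@_t *g cmul s t >>.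

Lemma freeC_mulw (d1 d2 : {fset cmonom}) u v :
  (msupp u `<=` d1)%fset -> (msupp v `<=` d2)%fset ->
  freeC_mul u v =
  \sum_(s <- d1) \sum_(t <- d2) << u@_s * v@_t *g cmul s t >>.
Proof.
move=> le1 le2; rewrite /freeC_mul.
rewrite [LHS](big_fset_incl _ le1) /=; last first.
  move=> s _ /mcoeff_outdom ->; apply: big1 => t _.
  by rewrite mul0r monalgU0.
apply: eq_bigr => s _; apply: (big_fset_incl _ le2).
by move=> t _ /mcoeff_outdom ->; rewrite mulr0 monalgU0.
Qed.

Lemma freeC_mulC : commutative freeC_mul.
Proof.
move=> u v; rewrite /freeC_mul exchange_big /=.
by apply: eq_bigr => t _; apply: eq_bigr => s _; rewrite mulrC cmulC.
Qed.

Lemma freeC_mulDl : left_distributive freeC_mul +%R.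
Proof.
move=> u1 u2 v; pose d := (msupp u1 `|` msupp u2)%fset.
rewrite (@freeC_mulw d (msupp v) (u1 + u2)) ?msuppD_le //.
rewrite (@freeC_mulw d (msupp v) u1) ?fsubsetUl //.
rewrite (@freeC_mulw d (msupp v) u2) ?fsubsetUr //.
rewrite -big_split /=; apply: eq_bigr => s _.
rewrite -big_split /=; apply: eq_bigr => t _.
by rewrite mcoeffD mulrDl monalgUD.
Qed.

Lemma malgZU (a c : R) (s : cmonom) :
  a *: (<< c *g s >> : {malg R[cmonom]}) = << a * c *g s >>.
Proof. by apply/malgP => k; rewrite mcoeffZ !mcoeffU mulrnAr. Qed.

Lemma freeC_mulZl (a : R) u v : freeC_mul (a *: u) v = a *: freeC_mul u v.
Proof.
rewrite (@freeC_mulw (msupp u) (msupp v)) ?msuppZ_le //.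
rewrite scaler_sumr; apply: eq_bigr => s _.
rewrite scaler_sumr; apply: eq_bigr => t _.
by rewrite malgZU mcoeffZ mulrA.
Qed.

HB.instance Definition _ := Lmodule_isCommNAlg.Build R (freeC R)
  freeC_mulC freeC_mulDl freeC_mulZl.

Definition genX : freeC R := << mX >>.
Definition genY : freeC R := << mY >>.

Section Eval.
Context (A : commNAlgType R) (a b : A).

Fixpoint btree_eval (t : btree) : A :=
  match t with
  | TX => a
  | TY => b
  | TNode s u => btree_eval s ** btree_eval u
  end.

(* The homomorphism sending x to [a] and y to [b]; for [A = freeC R] this is
   the endomorphism written (a, b). *)
Definition freeC_eval (u : freeC R) : A :=
  \sum_(s <- msupp u) u@_s *: btree_eval (cmonom_tree s).

End Eval.

End FreeC.

(** * Universal property of [freeC R] *)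

Section Universal.
Context (R : comNzRingType) (A : commNAlgType R) (a b : A).

Lemma nmulDr : right_distributive (@nmul R A) +%R.
Proof. by move=> u v w; rewrite nmulC nmulDl !(nmulC u). Qed.

Lemma nmulZr (c : R) (u v : A) : u ** (c *: v) = c *: (u ** v).
Proof. by rewrite nmulC nmulZl nmulC. Qed.

Lemma nmul0l (u : A) : 0 ** u = 0.
Proof. by rewrite -[X in X ** u](scale0r (0 : A)) nmulZl scale0r. Qed.

Lemma nmul0r (u : A) : u ** 0 = 0.
Proof. by rewrite nmulC nmul0l. Qed.

Lemma btree_eval_node (s t : btree) :
  btree_eval a b (node s t) = btree_eval a b s ** btree_eval a b t.
Proof. by rewrite /node; case: ifP => //= _; rewrite nmulC. Qed.

Lemma freeC_evalw (d : {fset cmonom}) (u : freeC R) :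
  (msupp u `<=` d)%fset ->
  freeC_eval a b u = \sum_(s <- d) u@_s *: btree_eval a b (cmonom_tree s).
Proof.
move=> le; apply: (big_fset_incl _ le).
by move=> s _ /mcoeff_outdom ->; rewrite scale0r.
Qed.

Lemma freeC_eval_linear : linear (freeC_eval a b).
Proof.
move=> c u v; pose d := (msupp u `|` msupp v)%fset.
have le : (msupp (c *: u + v) `<=` d)%fset.
  apply: (fsubset_trans (msuppD_le _ _)); apply: fsetUSS => //.
  exact: msuppZ_le.
rewrite (freeC_evalw le) (@freeC_evalw d u) ?fsubsetUl //.
rewrite (@freeC_evalw d v) ?fsubsetUr // scaler_sumr -big_split /=.
by apply: eq_bigr => s _; rewrite mcoeffD mcoeffZ scalerDl scalerA.
Qed.

HB.instance Definition _ :=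
  GRing.isLinear.Build R (freeC R) A _ (freeC_eval a b) freeC_eval_linear.

Lemma freeC_evalU (c : R) (s : cmonom) :
  freeC_eval a b (<< c *g s >> : {malg R[cmonom]}) =
  c *: btree_eval a b (cmonom_tree s).
Proof.
by rewrite (@freeC_evalw [fset s]%fset) ?msuppU_le // big_seq_fset1 mcoeffUU.
Qed.

Lemma freeC_eval_hom : alg_hom (freeC_eval a b).
Proof.
split=> [|u v]; first exact: freeC_eval_linear.
rewrite [u ** v]/(freeC_mul u v) /freeC_mul raddf_sum /=.
rewrite [in RHS]/freeC_eval.
rewrite [RHS](big_morph (fun w => w ** _) (id1 := 0) (op1 := +%R)) /=;
  [|by move=> ? ?; rewrite nmulDl|by rewrite nmul0l].
apply: eq_bigr => s _; rewrite raddf_sum /=.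
rewrite [RHS](big_morph (nmul _) (id1 := 0) (op1 := +%R)) /=;
  [|by move=> ? ?; rewrite nmulDr|by rewrite nmul0r].
apply: eq_bigr => t _.
by rewrite freeC_evalU /= btree_eval_node nmulZl nmulZr scalerA.
Qed.

Lemma freeC_evalX : freeC_eval a b (genX R) = a.
Proof. by rewrite freeC_evalU scale1r. Qed.

Lemma freeC_evalY : freeC_eval a b (genY R) = b.
Proof. by rewrite freeC_evalU scale1r. Qed.

Lemma freeC_mulUU (s t : cmonom) :
  (<< s >> : freeC R) ** (<< t >> : freeC R) = << cmul s t >>.
Proof.
rewrite [LHS](@freeC_mulw R [fset s]%fset [fset t]%fset) ?msuppU_le //.
by rewrite !big_seq_fset1 !mcoeffUU mulr1.
Qed.

Lemma freeC_eval_unique (f : freeC R -> A) :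
  alg_hom f -> f (genX R) = a -> f (genY R) = b -> f =1 freeC_eval a b.
Proof.
move=> [flin fM] fX fY u.
pose F : {linear freeC R -> A} :=
  HB.pack f (GRing.isLinear.Build R (freeC R) A _ f flin).
have fU s : f << s >> = btree_eval a b (cmonom_tree s).
  elim/cmonom_elim: s => // s t IHs IHt.
  by rewrite -freeC_mulUU fM IHs IHt btree_eval_node.
rewrite {1}(monalgE u) -[LHS]/(F _) [LHS](raddf_sum F) /=.
apply: eq_bigr => s _.
have -> : << u@_s *g s >> = u@_s *: (<< s >> : freeC R).
  by rewrite [RHS]malgZU mulr1.
by rewrite -[LHS]/(F _) linearZ /= fU.
Qed.

End Universal.

(** * Tame and wild automorphisms *)

Section Tame.
Context (R : comUnitRingType).
Local Notation B := (freeC R).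
Local Notation x := (genX R).
Local Notation y := (genY R).

Definition elementary (phi : B -> B) : Prop :=
  (exists (alpha : R) (f : B),
     [/\ alpha \is a GRing.unit, subalg_gen (eq y) f &
         phi =1 freeC_eval (alpha *: x + f) y]) \/
  (exists (beta : R) (g : B),
     [/\ beta \is a GRing.unit, subalg_gen (eq x) g &
         phi =1 freeC_eval x (beta *: y + g)]).

(* The subgroup generated by the elementary automorphisms, closed under
   pointwise equality of maps. *)
Inductive tame : (B -> B) -> Prop :=
| tame_elementary phi : elementary phi -> tame phi
| tame_id : tame id
| tame_comp phi psi : tame phi -> tame psi -> tame (phi \o psi)
| tame_inv phi psi : tame phi -> cancel phi psi -> cancel psi phi -> tame psi
| tame_ext phi psi : tame phi -> phi =1 psi -> tame psi.

Definition wild_aut (phi : B -> B) : Prop := alg_aut phi /\ ~ tame phi.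

End Tame.

(* Main.v *)
Require Import Defs.
From mathcomp Require Import all_boot all_algebra.
From HB Require Import structures.
From mathcomp Require Import ring zify.
Import GRing.Theory.
Local Open Scope ring_scope.

Set Implicit Arguments.
Unset Strict Implicit.
Unset Printing Implicit Defensive.

(** The automorphism omega is the value at e = 1 of the one-parameter group
    [nagata z e] = (x + 2e yt + z e^2 t^2, y + z e t), where t = zx - y^2.  Every
    [nagata z e] fixes t ([nagata_fixes_t]), so e |-> [nagata z e] turns sums
    into composites ([nagata_add]), and [nagata z (- e)] is the inverse.

    For wildness, the free algebra is mapped to the commutative polynomials in
    two variables, where a pair of images (f1, f2) has a total degree.  The
    pairs that elementary moves produce from (x, y) lie in a class that is described
    without any uniqueness of factorizations: the [reachable] pairs
    (h + p(f2), f2), where p is divisible by the square of its variable and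
    (h, f2) is [balanced], a condition that forces deg h <= deg f2.  The set of
    reachable pairs is stable under elementary moves ([reachable_elementary],
    [reachable_swap]); as the inverse of such a move is one of the same form,
    reachability is an invariant of the whole tame group ([tame_preserves]).

    In a reachable pair with deg f1 > deg f2, the leading form of f1 is that of
    p(f2), hence a power of the leading form of f2 times a coefficient lying in
    the ground ring.  For omega the leading forms are z y^4 and - z y^2, so
    z = c z^2 for some scalar c, and z is a unit ([nagata_unreachable]). *)

(** * Homomorphisms of commutative algebras *)

Section Hom.
Context (R : comNzRingType).

Lemma alg_hom_id (A : commNAlgType R) : alg_hom (@id A).
Proof. by []. Qed.

Lemma alg_hom_comp (A B C : commNAlgType R) (f : B -> C) (g : A -> B) :
  alg_hom f -> alg_hom g -> alg_hom (f \o g).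
Proof.
move=> [flin fM] [glin gM]; split=> [a u v|u v] /=; first by rewrite glin flin.
by rewrite gM fM.
Qed.

Lemma alg_hom_inv (A B : commNAlgType R) (f : A -> B) (g : B -> A) :
  alg_hom f -> cancel f g -> cancel g f -> alg_hom g.
Proof.
move=> [flin fM] fK gK; split=> [a u v|u v]; apply: (can_inj fK).
  by rewrite flin !gK.
by rewrite fM !gK.
Qed.

Lemma alg_hom_ext (A B : commNAlgType R) (f g : A -> B) :
  f =1 g -> alg_hom f -> alg_hom g.
Proof.
by move=> e [flin fM]; split=> [a u v|u v]; rewrite -!e ?flin ?fM.
Qed.

Section Rules.
Context (A B : commNAlgType R) (f : A -> B) (hf : alg_hom f).

Lemma alg_hom0 : f 0 = 0.
Proof. by have := hf.1 (-1) 0 0; rewrite scaler0 addr0 scaleN1r addNr. Qed.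

Lemma alg_homD u v : f (u + v) = f u + f v.
Proof. by have := hf.1 1 u v; rewrite !scale1r. Qed.

Lemma alg_homZ a u : f (a *: u) = a *: f u.
Proof. by have := hf.1 a u 0; rewrite alg_hom0 !addr0. Qed.

Lemma alg_homN u : f (- u) = - f u.
Proof. by rewrite -scaleN1r alg_homZ scaleN1r. Qed.

Lemma alg_homM u v : f (u ** v) = f u ** f v.
Proof. exact: hf.2. Qed.

End Rules.

Lemma freeC_hom_id (f : freeC R -> freeC R) :
  alg_hom f -> f (genX R) = genX R -> f (genY R) = genY R -> f =1 id.
Proof.
move=> hf fX fY u.
rewrite (freeC_eval_unique hf fX fY).
by rewrite -(freeC_eval_unique (alg_hom_id (freeC R)) erefl erefl).
Qed.

End Hom.

(** * The Nagata automorphism *)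

(** The two identities behind the one-parameter group, for arbitrary elements in
    the roles of x and y. *)
Section Shift.
Context (R : comNzRingType) (A : commNAlgType R).
Implicit Types (u v t : A) (z e f : R).

Lemma nmul_sqrD u v :
  (u + v) ** (u + v) = u ** u + 2%:R *: (u ** v) + v ** v.
Proof.
by rewrite nmulDl !nmulDr (nmulC v u) scalerDl scale1r !addrA.
Qed.

Lemma shift_invariant z e u v t :
  z *: (u + (2%:R * e) *: (v ** t) + (z * e ^+ 2) *: (t ** t))
    - (v + (z * e) *: t) ** (v + (z * e) *: t) = z *: u - v ** v.
Proof.
rewrite nmul_sqrD !scalerDr !nmulZr !nmulZl !scalerA.
have -> : z * (2%:R * e) = 2%:R * (z * e) by ring.
have -> : z * (z * e ^+ 2) = z * e * (z * e) by ring.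
by rewrite !opprD [LHS]addrACA subrr addr0 [LHS]addrACA subrr addr0.
Qed.

Lemma shift_add z e f u v t :
  u + (2%:R * e) *: (v ** t) + (z * e ^+ 2) *: (t ** t)
    + (2%:R * f) *: ((v + (z * e) *: t) ** t) + (z * f ^+ 2) *: (t ** t)
  = u + (2%:R * (e + f)) *: (v ** t) + (z * (e + f) ^+ 2) *: (t ** t).
Proof.
rewrite nmulDl nmulZl scalerDr scalerA.
have -> : z * (e + f) ^+ 2
  = z * e ^+ 2 + 2%:R * f * (z * e) + z * f ^+ 2 by ring.
rewrite mulrDr !scalerDl !addrA; congr (_ + _ + _).
by rewrite (addrAC _ ((z * e ^+ 2) *: _)).
Qed.

End Shift.

Section Nagata.
Context (R : comNzRingType) (z : R).
Local Notation x := (genX R).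
Local Notation y := (genY R).

Definition nagata_t : freeC R := z *: x - y ** y.

(** The parameter e is the time of the flow: formally this is the exponential of
    e times the derivation x |-> 2yt, y |-> zt, which kills t. *)
Definition nagata (e : R) : freeC R -> freeC R :=
  freeC_eval (x + (2%:R * e) *: (y ** nagata_t)
                + (z * e ^+ 2) *: (nagata_t ** nagata_t))
             (y + (z * e) *: nagata_t).

Lemma nagata_hom e : alg_hom (nagata e).
Proof. exact: freeC_eval_hom. Qed.

(** The shifts of x and y cancel in zx - y^2 by completing the square:
    (y + zet)^2 = y^2 + z (2e yt + z e^2 t^2). *)
Lemma nagata_fixes_t e : nagata e nagata_t = nagata_t.
Proof.
have he := nagata_hom e.
rewrite {1}/nagata_t (alg_homD he) (alg_homN he) (alg_homZ he) (alg_homM he).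
rewrite [nagata e x]freeC_evalX [nagata e y]freeC_evalY.
exact: shift_invariant.
Qed.

(** Since t is fixed, substituting one map of the family into another only
    shifts y by zet inside the term 2f yt, which supplies the cross term of
    (e + f)^2. *)
Lemma nagata_add e f : nagata e \o nagata f =1 nagata (e + f).
Proof.
have he := nagata_hom e.
apply: freeC_eval_unique; first exact: alg_hom_comp he (nagata_hom f).
- rewrite /= [nagata f x]freeC_evalX !(alg_homD he) !(alg_homZ he) !(alg_homM he).
  rewrite nagata_fixes_t [nagata e x]freeC_evalX [nagata e y]freeC_evalY.
  exact: shift_add.
- rewrite /= [nagata f y]freeC_evalY (alg_homD he) (alg_homZ he).
  by rewrite nagata_fixes_t [nagata e y]freeC_evalY mulrDr scalerDl addrA.
Qed.

Lemma nagata0 : nagata 0 =1 id.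
Proof.
apply: freeC_hom_id; first exact: nagata_hom.
  by rewrite [LHS]freeC_evalX expr0n /= !mulr0 !scale0r !addr0.
by rewrite [LHS]freeC_evalY mulr0 scale0r addr0.
Qed.

Lemma nagata_aut e : alg_aut (nagata e).
Proof.
split; first exact: nagata_hom.
by exists (nagata (- e)) => u; have /= -> := nagata_add _ _ u;
  rewrite ?addNr ?subrr nagata0.
Qed.

End Nagata.

(** * Bivariate polynomials *)

Section Bipoly.
Context (R : idomainType).

(** The alias hides the module structure of [{poly {poly R}}] over [{poly R}], so
    that the polynomials become a commutative algebra over [R] itself. *)
Definition bipoly : Type := {poly {poly R}}.

HB.instance Definition _ := GRing.Zmodule.copy bipoly {poly {poly R}}.

Definition bipoly_scale (a : R) (u : bipoly) : bipoly :=
  (a%:P : {poly R}) *: (u : {poly {poly R}}).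

Lemma bipoly_scaleA a b u :
  bipoly_scale a (bipoly_scale b u) = bipoly_scale (a * b) u.
Proof. by rewrite /bipoly_scale scalerA polyCM. Qed.

Lemma bipoly_scale1 : left_id 1 bipoly_scale.
Proof. by move=> u; rewrite /bipoly_scale scale1r. Qed.

Lemma bipoly_scaleDr : right_distributive bipoly_scale +%R.
Proof. by move=> a u v; rewrite /bipoly_scale -scalerDr. Qed.

Lemma bipoly_scaleDl u : {morph bipoly_scale^~ u : a b / a + b}.
Proof. by move=> a b; rewrite /bipoly_scale polyCD scalerDl. Qed.

HB.instance Definition _ := GRing.Zmodule_isLmodule.Build R bipoly
  bipoly_scaleA bipoly_scale1 bipoly_scaleDr bipoly_scaleDl.

Definition bipoly_mul (u v : bipoly) : bipoly :=
  (u : {poly {poly R}}) * (v : {poly {poly R}}).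

Lemma bipoly_mulC : commutative bipoly_mul.
Proof. by move=> u v; rewrite /bipoly_mul mulrC. Qed.

Lemma bipoly_mulDl : left_distributive bipoly_mul +%R.
Proof. by move=> u v w; rewrite /bipoly_mul -mulrDl. Qed.

Lemma bipoly_mulZl (a : R) (u v : bipoly) :
  bipoly_mul (a *: u) v = a *: bipoly_mul u v.
Proof.
exact: (esym (scalerAl (a%:P : {poly R}) (u : {poly {poly R}}) v)).
Qed.

HB.instance Definition _ := Lmodule_isCommNAlg.Build R bipoly
  bipoly_mulC bipoly_mulDl bipoly_mulZl.

End Bipoly.

(** * Pairs of polynomials reachable by elementary moves *)

Section Reachable.
Context (R : idomainType).
Local Notation P := {poly {poly R}}.
Implicit Types (a b c d : R) (r q : {poly R}) (f g h : P).

Local Notation "c %:PP" := ((c%:P)%:P : P) (at level 2, format "c %:PP").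

(** The value at [f] of a polynomial whose coefficients are scalars: these are
    the elements of the (unital) subalgebra generated by [f]. *)
Definition at_poly r f : P := map_poly polyC r \Po f.

(** The images of x and y are sT and T, where T is the outer variable: with
    this choice the degree in T is the total degree, and every nonzero linear
    combination of x and y has degree exactly 1. *)
Definition bipX : P := ('X)%:P * 'X.
Definition bipY : P := 'X.

Lemma at_poly0 f : at_poly 0 f = 0.
Proof. by rewrite /at_poly rmorph0 comp_poly0. Qed.

Lemma at_polyD r q f : at_poly (r + q) f = at_poly r f + at_poly q f.
Proof. by rewrite /at_poly rmorphD comp_polyD. Qed.

Lemma at_polyN r f : at_poly (- r) f = - at_poly r f.
Proof. by rewrite /at_poly rmorphN linearN. Qed.

Lemma at_polyM r q f : at_poly (r * q) f = at_poly r f * at_poly q f.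
Proof. by rewrite /at_poly rmorphM comp_polyM. Qed.

Lemma at_polyC c f : at_poly c%:P f = c %:PP.
Proof. by rewrite /at_poly map_polyC comp_polyC. Qed.

Lemma at_polyX f : at_poly 'X f = f.
Proof. by rewrite /at_poly map_polyX comp_polyX. Qed.

Lemma at_poly_scale r c f :
  at_poly r (c %:PP * f) = at_poly (r \Po (c *: 'X)) f.
Proof.
elim/poly_ind: r => [|r e IH]; first by rewrite comp_poly0 !at_poly0.
rewrite comp_polyD comp_polyM comp_polyX comp_polyC !at_polyD !at_polyM IH.
by rewrite !at_polyC !at_polyX -mul_polyC at_polyM at_polyC at_polyX.
Qed.

Lemma const0l f : 0%:PP * f = 0.
Proof. by rewrite !polyC0 mul0r. Qed.

Lemma const1l f : 1%:PP * f = f.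
Proof. by rewrite !polyC1 mul1r. Qed.

(** Pairs whose second component has the larger degree, in the weak sense.
    A triangular step replaces (h1, h2) by (g, h2), where g = h1 + h2^2 r(h2) has
    degree greater than h2; the linear change that follows must bring g into
    the second component, whence [c != 0]. *)
Inductive balanced : P -> P -> Prop :=
| balanced_linear a b c d :
    a * d - b * c \is a GRing.unit ->
    balanced (a %:PP * bipX + b %:PP * bipY) (c %:PP * bipX + d %:PP * bipY)
| balanced_step h1 h2 r a b c d :
    balanced h1 h2 -> r != 0 -> c != 0 -> a * d - b * c \is a GRing.unit ->
    balanced (a %:PP * (h1 + h2 ^+ 2 * at_poly r h2) + b %:PP * h2)
             (c %:PP * (h1 + h2 ^+ 2 * at_poly r h2) + d %:PP * h2).

(** The case r = 0 is allowed, so that a move which undoes the previous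
    triangular step stays inside the predicate. *)
Definition reachable f1 f2 : Prop :=
  exists h r, balanced h f2 /\ f1 = h + f2 ^+ 2 * at_poly r f2.

(** A triangular linear change of the pair is absorbed by the linear change that
    ends its construction; it multiplies the entry [c] by a unit. *)
Lemma balanced_triangular a b d h1 h2 :
  a \is a GRing.unit -> d \is a GRing.unit -> balanced h1 h2 ->
  balanced (a %:PP * h1 + b %:PP * h2) (d %:PP * h2).
Proof.
move=> ua ud; have dn0 : d != 0 by apply: contraTneq ud => ->; rewrite unitr0.
have mix1 a' b' c' d' u v :
    a %:PP * (a' %:PP * u + b' %:PP * v) + b %:PP * (c' %:PP * u + d' %:PP * v)
      = (a * a' + b * c') %:PP * u + (a * b' + b * d') %:PP * v.
  by rewrite !(polyCD, polyCM); ring.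
have mix2 c' d' u v : d %:PP * (c' %:PP * u + d' %:PP * v)
    = (d * c') %:PP * u + (d * d') %:PP * v.
  by rewrite !polyCM; ring.
have det a' b' c' d' : a' * d' - b' * c' \is a GRing.unit ->
    (a * a' + b * c') * (d * d') - (a * b' + b * d') * (d * c')
      \is a GRing.unit.
  move=> u; have -> : (a * a' + b * c') * (d * d') - (a * b' + b * d') * (d * c')
    = a * d * (a' * d' - b' * c') by ring.
  by rewrite !unitrM ua ud.
case=> [a' b' c' d' u | k1 k2 r a' b' c' d' bal rn0 cn0 u]; rewrite mix1 mix2.
  by apply: balanced_linear; apply: det.
by apply: balanced_step => //; [rewrite mulf_neq0 | apply: det].
Qed.

(** Over a domain the leading term of a polynomial in [h] is that of its top
    power of [h], because distinct powers of [h] have distinct degrees. *)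
Lemma at_poly_size_lead r h : r != 0 -> (1 < size h)%N ->
  size (h ^+ 2 * at_poly r h) = ((size r).+1 * (size h).-1).+1 /\
  lead_coef (h ^+ 2 * at_poly r h)
    = lead_coef h ^+ 2 * ((lead_coef r)%:P * lead_coef h ^+ (size r).-1).
Proof.
move=> rn0 sh; have sz : size (map_poly (polyC : R -> {poly R}) r) = size r.
  by apply: size_map_inj_poly => //; apply: polyC_inj.
have hn0 : h != 0 by rewrite -size_poly_gt0; lia.
have lr : lead_coef (map_poly (polyC : R -> {poly R}) r) = (lead_coef r)%:P.
  by rewrite lead_coef_map_inj //; apply: polyC_inj.
have sr : (0 < size r)%N by rewrite size_poly_gt0.
have an0 : at_poly r h != 0.
  by rewrite /at_poly comp_poly_eq0 // -size_poly_eq0 sz -lt0n.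
split; last by rewrite lead_coefM lead_coef_exp lead_coef_comp // lr sz.
rewrite size_mul ?expf_neq0 //.
have := size_comp_poly (map_poly polyC r) h; rewrite sz -/(at_poly r h).
have := size_exp h 2; move: an0 (expf_neq0 2 hn0).
rewrite -!size_poly_gt0; move: sh sr; clear.
case: (size h) => [|m] //= _; case: (size r) => [|k] //= _.
by move: (size _) (size _) => p a; rewrite !mulSn; lia.
Qed.

Lemma size_const_mul c f : c != 0 -> size (c %:PP * f) = size f.
Proof. by move=> cn0; rewrite mul_polyC size_scale // polyC_eq0. Qed.

Lemma size_const_mul_le c f : (size (c %:PP * f)%R <= size f)%N.
Proof. by rewrite mul_polyC size_scale_leq. Qed.

(** In a triangular step the added term has degree at least twice that of [h2],
    so it dominates [h1] and [h2] together; a nonzero [c] then gives the second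
    component the top degree. *)
Lemma balanced_size h1 h2 :
  balanced h1 h2 -> (1 < size h2)%N /\ (size h1 <= size h2)%N.
Proof.
elim=> {h1 h2} [a b c d u | h1 h2 r a b c d _ [sh2 sh1] rn0 cn0 u].
  (* Degree 1 in T, with coefficient a' s + b'. *)
  have lin a' b' : a' %:PP * bipX + b' %:PP * bipY
      = (a' *: 'X + b'%:P : {poly R}) *: 'X.
    rewrite /bipX /bipY -!mul_polyC polyCD !polyCM; ring.
  have lin0 a' b' : (a' *: 'X + b'%:P == 0 :> {poly R}) = (a' == 0) && (b' == 0).
    apply/eqP/andP => [e|[/eqP-> /eqP->]]; last by rewrite scale0r add0r.
    have := congr1 (fun p : {poly R} => p`_0) e.
    have := congr1 (fun p : {poly R} => p`_1) e.
    rewrite !(coef0, coefD, coefZ, coefX, coefC) /= mulr1 mulr0 addr0 add0r.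
    by move=> -> ->.
  rewrite !lin.
  have cd : c *: 'X + d%:P != 0 :> {poly R}.
    rewrite lin0; apply: contraTN u => /andP[/eqP-> /eqP->].
    by rewrite !mulr0 subrr unitr0.
  by rewrite size_scale // size_polyX (leq_trans (size_scale_leq _ _)) ?size_polyX.
have [sz _] := at_poly_size_lead rn0 sh2.
have sr : (0 < size r)%N by rewrite size_poly_gt0.
have lt : (size h2 < size (h2 ^+ 2 * at_poly r h2)%R)%N by rewrite sz; nia.
set g := h1 + _.
have sg : size g = size (h2 ^+ 2 * at_poly r h2).
  by rewrite /g addrC size_polyDl // (leq_ltn_trans sh1).
have s2 : size (c %:PP * g + d %:PP * h2) = size g.
  rewrite size_polyDl; first exact: size_const_mul.
  by apply: leq_ltn_trans (size_const_mul_le _ _) _; rewrite size_const_mul // sg.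
rewrite s2; split; first by rewrite sg (ltn_trans sh2).
rewrite (leq_trans (size_polyD _ _)) // geq_max size_const_mul_le /=.
by rewrite (leq_trans (size_const_mul_le _ _)) // ltnW // sg.
Qed.

Lemma reachable_base : reachable bipX bipY.
Proof.
exists bipX, 0; rewrite at_poly0 mulr0 addr0; split=> //.
have := @balanced_linear 1 0 0 1; rewrite !const1l !const0l addr0 add0r.
by apply; rewrite mulr1 mulr0 subr0 unitr1.
Qed.

Lemma balanced_reachable h1 h2 : balanced h1 h2 -> reachable h1 h2.
Proof. by move=> bal; exists h1, 0; rewrite at_poly0 mulr0 addr0. Qed.

(** If r != 0 the swapped pair is a new triangular step followed by the exchange.
    If r = 0 the exchange is merged with the last linear change, unless this
    makes [c] vanish: then the last triangular step itself is left exposed. *)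
Lemma reachable_swap f1 f2 : reachable f1 f2 -> reachable f2 f1.
Proof.
case=> h [r [bal ->]]; have [->|rn0] := eqVneq r 0; last first.
  apply: balanced_reachable.
  have := @balanced_step h f2 r 0 1 1 0 bal rn0 (oner_neq0 _).
  rewrite !const1l !const0l add0r addr0; apply.
  by rewrite mulr0 mulr1 sub0r unitrN unitr1.
rewrite at_poly0 mulr0 addr0.
case: bal => [a b c d u | h1 h2 q a b c d bal qn0 cn0 u].
  apply/balanced_reachable/balanced_linear.
  by rewrite -opprB unitrN [c * b]mulrC [d * a]mulrC.
have [a0|an0] := eqVneq a 0; last first.
  apply/balanced_reachable/balanced_step => //.
  by rewrite -opprB unitrN [c * b]mulrC [d * a]mulrC.
(* Here the original pair is (b h2, c (h1 + h2^2 q(h2)) + d h2), and h2 is rewritten in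
   terms of the new second component b h2. *)
move: u; rewrite a0 !mul0r sub0r unitrN unitrM add0r => /andP[ub uc].
exists (c %:PP * h1 + d %:PP * h2).
exists ((c / b ^+ 2) *: (q \Po (b^-1 *: 'X))).
split; first exact: balanced_triangular.
rewrite -mul_polyC at_polyM at_polyC -at_poly_scale.
rewrite [b^-1 %:PP * _]mulrA -!polyCM mulVr // mul1r.
have -> : (c / b ^+ 2)%:PP = c %:PP * (b^-1) %:PP ^+ 2 :> P.
  by rewrite -!polyC_exp -!polyCM exprVn.
have e : b %:PP * (b^-1) %:PP = 1 :> P by rewrite -!polyCM mulrV.
have -> : (b %:PP * h2) ^+ 2 * (c %:PP * (b^-1) %:PP ^+ 2 * at_poly q h2)
   = (b %:PP * (b^-1) %:PP) ^+ 2 * (c %:PP * (h2 ^+ 2 * at_poly q h2)) by ring.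
by rewrite e expr1n mul1r; ring.
Qed.

(** The linear part of the move is absorbed by the balanced pair, the rest is
    added to the polynomial r, which may become 0. *)
Lemma reachable_elementary alpha c q f1 f2 : alpha \is a GRing.unit ->
  reachable f1 f2 ->
  reachable (alpha %:PP * f1 + (c %:PP * f2 + f2 ^+ 2 * at_poly q f2)) f2.
Proof.
move=> ua [h [r [bal ->]]].
exists (alpha %:PP * h + c %:PP * f2), (alpha%:P * r + q); split.
  by have := balanced_triangular c ua (unitr1 _) bal; rewrite const1l.
by rewrite at_polyD at_polyM at_polyC; ring.
Qed.

(** The move is undone by a move of the same form. *)
Lemma reachable_elementary_iff alpha c q f1 f2 : alpha \is a GRing.unit ->
  reachable f1 f2 <->
  reachable (alpha %:PP * f1 + (c %:PP * f2 + f2 ^+ 2 * at_poly q f2)) f2.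
Proof.
move=> ua; split; first exact: reachable_elementary.
move/(@reachable_elementary alpha^-1 (- (alpha^-1 * c)) (- (alpha^-1%:P * q))).
rewrite unitrV => /(_ ua); congr reachable.
have e : (alpha^-1) %:PP * alpha %:PP = 1 :> P by rewrite -!polyCM mulVr.
rewrite at_polyN at_polyM at_polyC !polyCN !polyCM.
rewrite -[RHS]const1l !polyC1 -e; ring.
Qed.

(** Algebra homomorphisms to [bipoly R], typed so that their values use the ring
    operations of [{poly {poly R}}]. *)
Definition bip_hom (A : commNAlgType R) (t : A -> P) : Prop :=
  @alg_hom R A (bipoly R) t.

Arguments bip_hom A t : clear implicits.

Section Rules.
Context (A : commNAlgType R) (t : A -> P) (ht : bip_hom A t).

Lemma bip_homD u v : t (u + v) = t u + t v. Proof. exact: (alg_homD ht). Qed.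
Lemma bip_homN u : t (- u) = - t u. Proof. exact: (alg_homN ht). Qed.
Lemma bip_hom0 : t 0 = 0. Proof. exact: (alg_hom0 ht). Qed.
Lemma bip_homZ a u : t (a *: u) = a %:PP * t u.
Proof. by rewrite mul_polyC; exact: (alg_homZ ht). Qed.
Lemma bip_homM u v : t (u ** v) = t u * t v. Proof. exact: (alg_homM ht). Qed.

End Rules.

(** An element of the subalgebra generated by [w] is a nonassociative polynomial
    in [w] without constant term; a commutative and associative algebra only
    sees the ordinary polynomial c X + X^2 q, the same for every [t]. *)
Lemma subalg_gen_at_poly (A : commNAlgType R) (w u : A) :
  subalg_gen (eq w) u -> exists c q, forall t : A -> P, bip_hom A t ->
    t u = c %:PP * t w + t w ^+ 2 * at_poly q (t w).
Proof.
elim=> {u} [u <- || u v _ [c [q IH]] _ [d [r IH']] | a u _ [c [q IH]]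
           | u v _ [c [q IH]] _ [d [r IH']]].
- by exists 1, 0 => t _; rewrite mul1r at_poly0 mulr0 addr0.
- by exists 0, 0 => t ht; rewrite (bip_hom0 ht) mul0r at_poly0 mulr0 addr0.
- exists (c + d), (q + r) => t ht.
  by rewrite (bip_homD ht) IH // IH' // at_polyD !polyCD; ring.
- exists (a * c), (a%:P * q) => t ht.
  by rewrite (bip_homZ ht) IH // at_polyM at_polyC !polyCM; ring.
- exists 0, ((c%:P + 'X * q) * (d%:P + 'X * r)) => t ht.
  rewrite (bip_homM ht) IH // IH' //.
  by rewrite !(at_polyM, at_polyD, at_polyC, at_polyX); ring.
Qed.

End Reachable.

Arguments bip_hom {R} A t.

(** * Leading terms of the Nagata pair *)

Lemma size_lead_top (S : idomainType) (c : S) n (g : {poly S}) :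
  c != 0 -> (size g <= n)%N ->
  size (c *: 'X^n + g) = n.+1 /\ lead_coef (c *: 'X^n + g) = c.
Proof.
move=> cn0 sg; have lt : (size g < size (c *: 'X^n)%R)%N.
  by rewrite size_scale // size_polyXn ltnS.
rewrite size_polyDl // lead_coefDl // size_scale // size_polyXn.
by rewrite lead_coefZ lead_coefXn mulr1.
Qed.

(** The pair has degrees 4 and 2 in T.  Were it reachable, the first component
    would have the leading term of f2^2 r(f2), so r would be a constant e by
    degrees, and z = e z^2 by leading coefficients. *)
Lemma nagata_unreachable (R : idomainType) (z : R) :
  let s := (z%:P)%:P * bipX R - bipY R * bipY R in
  z != 0 -> z \isn't a GRing.unit ->
  ~ reachable (bipX R + (2%:R%:P)%:P * (bipY R * s) + (z%:P)%:P * (s * s))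
              (bipY R + (z%:P)%:P * s).
Proof.
move=> s zn0 zu; pose A : {poly R} := z%:P * 'X.
have sE : s = A%:P * 'X - 'X * 'X.
  by rewrite /s /bipX /bipY /A !polyCM mulrA.
set f1 := bipX R + _ + _; set f2 := bipY R + _.
have f1E : f1 = z%:P *: 'X^4 + Poly [:: 0; 'X;
    2%:R%:P * A + z%:P * A ^+ 2; - (2%:R%:P + 2%:R%:P * z%:P * A)].
  rewrite /f1 sE /bipX /bipY /= !cons_poly_def -mul_polyC.
  by rewrite !(polyCN, polyCD, polyCM, polyC_exp, polyC0); ring.
have f2E : f2 = (- z)%:P *: 'X^2 + Poly [:: 0; 1 + z%:P * A].
  rewrite /f2 sE /bipY /= !cons_poly_def -mul_polyC.
  by rewrite !(polyCN, polyCD, polyCM, polyC0, polyC1); ring.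
have [s1 l1] : size f1 = 5 /\ lead_coef f1 = z%:P.
  by rewrite f1E; apply: size_lead_top; [rewrite polyC_eq0 | exact: size_Poly].
have [s2 l2] : size f2 = 3 /\ lead_coef f2 = (- z)%:P.
  rewrite f2E; apply: size_lead_top; last exact: size_Poly.
  by rewrite polyC_eq0 oppr_eq0.
case=> h [r [/balanced_size[_]]]; rewrite s2 => sh fE.
have [r0|rn0] := eqVneq r 0.
  by move: s1 sh; rewrite fE r0 at_poly0 mulr0 addr0 => ->.
have [|sz ld] := at_poly_size_lead rn0 (_ : 1 < size f2)%N; first by rewrite s2.
have sr : (0 < size r)%N by rewrite size_poly_gt0.
rewrite s2 /= in sz.
have lt : (size h < size (f2 ^+ 2 * at_poly r f2)%R)%N.
  by apply: leq_ltn_trans sh _; rewrite sz; move: (size r) sr; clear; lia.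
have r1 : size r = 1%N.
  by move: s1; rewrite fE addrC size_polyDl // sz; move: (size r); clear; lia.
move: l1; rewrite fE addrC lead_coefDl // ld l2 r1 expr0 mulr1.
rewrite -polyC_exp -polyCM sqrrN => /polyC_inj e.
case/negP: zu; apply/unitrPr; exists (lead_coef r).
by apply: (mulfI zn0); rewrite mulrA -expr2 e mulr1.
Qed.

(** * Invariance under tame automorphisms *)

Section Wild.
Context (R : idomainType).
Local Notation B := (freeC R).
Local Notation x := (genX R).
Local Notation y := (genY R).

(** Quantifying over all [t] makes the property stable under composition, and the
    equivalence makes it stable under inversion. *)
Definition preserves_reachable (phi : B -> B) : Prop :=
  alg_hom phi /\ forall t, bip_hom (freeC R) t ->
    reachable (t x) (t y) <-> reachable (t (phi x)) (t (phi y)).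

Lemma bip_hom_comp (t : B -> {poly {poly R}}) phi :
  bip_hom (freeC R) t -> alg_hom phi -> bip_hom (freeC R) (t \o phi).
Proof. exact: alg_hom_comp. Qed.

Lemma elementary_preserves phi : elementary phi -> preserves_reachable phi.
Proof.
case=> [] [a [f [ua sf e]]]; have [c [q tf]] := subalg_gen_at_poly sf.
  split=> [|t ht].
    by apply: alg_hom_ext (freeC_eval_hom _ _) => u; rewrite e.
  rewrite !e freeC_evalX freeC_evalY (bip_homD ht) (bip_homZ ht) tf //.
  exact: reachable_elementary_iff.
split=> [|t ht].
  by apply: alg_hom_ext (freeC_eval_hom _ _) => u; rewrite e.
rewrite !e freeC_evalX freeC_evalY (bip_homD ht) (bip_homZ ht) tf //.
have swap f1 f2 : reachable f1 f2 <-> reachable f2 f1 :> Prop.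
  by split; apply: reachable_swap.
rewrite swap (reachable_elementary_iff c q _ _ ua); exact: swap.
Qed.

Lemma tame_preserves phi : tame phi -> preserves_reachable phi.
Proof.
elim=> {phi} [phi | | phi psi _ [hphi IH] _ [hpsi IH'] | phi psi _ [hphi IH] K K'
             | phi psi _ [hphi IH] e].
- exact: elementary_preserves.
- by split; first exact: alg_hom_id.
- split=> [|t ht]; first exact: alg_hom_comp.
  rewrite (IH t ht); exact: IH' (bip_hom_comp ht hphi).
- have hpsi := alg_hom_inv hphi K K'; split=> // t ht.
  by apply: iff_sym; have := IH _ (bip_hom_comp ht hpsi); rewrite /= !K.
- split=> [|t ht]; first exact: alg_hom_ext e hphi.
  by rewrite -!e; apply: IH.
Qed.

Lemma nagata_wild (z : R) : z != 0 -> z \isn't a GRing.unit -> ~ tame (nagata z 1).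
Proof.
move=> zn0 zu /tame_preserves [_ /(_ (freeC_eval (bipX R : bipoly R) (bipY R : bipoly R)))].
set t := freeC_eval _ _; have ht : bip_hom (freeC R) t by exact: freeC_eval_hom.
case/(_ ht) => + _.
have tX : t x = bipX R by exact: freeC_evalX.
have tY : t y = bipY R by exact: freeC_evalY.
have tT : t (nagata_t z) = (z%:P)%:P * bipX R - bipY R * bipY R.
  by rewrite (bip_homD ht) (bip_homN ht) (bip_homZ ht) (bip_homM ht) tX tY.
rewrite [nagata z 1 x]freeC_evalX [nagata z 1 y]freeC_evalY expr1n !mulr1.
rewrite !(bip_homD ht) !(bip_homZ ht) !(bip_homM ht) tT tX tY.
by move/(_ (reachable_base R)); apply: nagata_unreachable.
Qed.

End Wild.

Theorem mainTheorem2 (Phi : idomainType) (hPhi : euclidean_domain Phi)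
    (z : Phi) (hz0 : z != 0) (hzU : z \isn't a GRing.unit) :
  let x := genX Phi in
  let y := genY Phi in
  let t := z *: x - y ** y in
  wild_aut (freeC_eval (x + 2%:R *: (y ** t) + z *: (t ** t)) (y + z *: t)).
Proof.
move=> x y t.
have <- : nagata z 1 = freeC_eval (x + 2%:R *: (y ** t) + z *: (t ** t))
                                  (y + z *: t).
  by rewrite /nagata expr1n !mulr1.
by split; [exact: nagata_aut | exact: nagata_wild].
Qed.
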